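(* Let $\operatorname{char}\mathsf k=0$, let $T=(1,2,\ldots,d-1,d^k,d-1,\ldots,2,1)$ ($d$ occurring $k\ge1$ times), $j=2d+k-3$, and let $P_\ell=P_{\ell,A}$ be the CIJT partition of diagonal lengths $T$ of a nonzero linear form $\ell$ on a graded complete intersection $A=R/\operatorname{Ann}F$ of Hilbert function $T$. For an integer $r$ let $\eta_r$ denote the number of difference-one hooks of $P_\ell$ whose hand has degree $r$. (i) If $k\ge2$, then for each $i\in[1,d]$, $$h^{d-i}_\ell(F)=0\iff \eta_{\,j-(d-i)}<\begin{cases}1&\text{if }i=1,\\2&\text{if }i\in[2,d].\end{cases}$$ (ii) If $k=1$, then for each $i\in[1,d-1]$, $$h^{d-1-i}_\ell(F)=0\iff\eta_{\,j-(d-1-i)}<2.$$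
   Context: $\mathsf k$ is an infinite field, $R=\mathsf k[x,y]$ with the standard grading. Here $T_i=i+1$ for $0\le i\le d-1$, $T_i=d$ for $d-1\le i\le d+k-2$, $T_i=j+1-i$ for $d+k-2\le i\le j$. For a partition $P=(p_1\ge\cdots\ge p_s>0)$, let $C_P$ be the set of monomials $y^{r-1}x^{c-1}$, $1\le r\le s$, $1\le c\le p_r$, and $E_P$ the set of monomials of $R$ not in $C_P$. The diagonal lengths of $P$ are $t_i=$ number of degree-$i$ monomials in $C_P$. A hook of $P$ is a subset of $C_P$ consisting of a corner monomial $c$, an arm $(c,xc,\ldots,\nu=x^{u-1}c)$ and a leg $(c,yc,\ldots,\mu=y^{v-1}c)$ with $x\nu\in E_P$ and $y\mu\in E_P$; $\nu$ is its hand, $\mu$ its foot, $u$ its arm length, $v$ its leg length. It is a difference-one hook if $u-v=1$. The Jordan type $P_{\ell,A}$ is the partition of Jordan block sizes of multiplication by $\ell$ on $A$; a CIJT partition of diagonal lengths $T$ is a partition of diagonal lengths $T$ that is $P_{\ell,A}$ for some graded Artinian complete intersection quotient $A$ of $R$ and nonzero linear form $\ell$. $R$ acts on $\mathcal E=\mathsf k[X,Y]$ by differentiation ($x=\partial_X$, $y=\partial_Y$), written $f\circ F$; $F\in\mathcal E_j$, $\operatorname{Ann}F=\{f\in R: f\circ F=0\}$. For $0\le i\le d-1$, given a basis $(\alpha_1,\ldots,\alpha_{i+1})$ of $A_i$, the $i$-th Hessian is $h^i(F)=\det[\alpha_u\alpha_v\circ F]_{u,v}$, well defined up to a nonzero scalar;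 for $\ell=ax+by$, $h^i_\ell(F)$ is its value at $(X,Y)=(a,b)$ (nonzero iff multiplication by $\ell^{j-2i}:A_i\to A_{j-i}$ is an isomorphism). *)

(* Defs.v *)
From HB Require Import structures.
From mathcomp Require Import all_boot all_order all_algebra.
From mathcomp Require Import mpoly.

Set Implicit Arguments.
Unset Strict Implicit.
Unset Printing Implicit Defensive.

Import GRing.Theory.

Local Open Scope ring_scope.

(** * Partitions, diagonal lengths and hooks *)

(* The pair (a, b) of natural numbers encodes the monomial x^a y^b; rows are
   numbered from 0, so that the b-th row of C_P is y^b, x y^b, ...,
   x^(p_b - 1) y^b. *)

Definition is_partition (P : seq nat) : bool :=
  sorted geq P && all (leq 1) P.

(* [nth 0 P b] is 0 for b >= size P. *)
Definition in_CP (P : seq nat) (a b : nat) : bool := (a < nth 0 P b)%N.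

(* Each monomial of degree i is x^(i - b) y^b for exactly one b <= i. *)
Definition diag_length (P : seq nat) (i : nat) : nat :=
  #|[set b : 'I_i.+1 | in_CP P (i - b) b]|.

(* The hook with corner x^a y^b, arm length u and leg length v. *)
Definition is_hook (P : seq nat) (a b u v : nat) : bool :=
  [&& (0 < u)%N, (0 < v)%N,
      all (fun t => in_CP P (a + t) b) (iota 0 u),
      all (fun t => in_CP P a (b + t)) (iota 0 v),
      ~~ in_CP P (a + u) b & ~~ in_CP P a (b + v)].

Definition hand_degree (a b u : nat) : nat := (a + u.-1 + b)%N.

(* A hook is determined by (a, b, u, v), and each of these numbers is at most
   |C_P| = sumn P, so the bound on the ordinals excludes no hook. *)
Definition diff_one_hooks (P : seq nat) (r : nat) : nat :=
  let N := (sumn P).+1 in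
  #|[set h : 'I_N * 'I_N * 'I_N * 'I_N |
      let: (a, b, u, v) := h in
      [&& is_hook P a b u v, u == v.+1 :> nat & hand_degree a b u == r]]|.

(** * The sequence T = (1, 2, ..., d-1, d^k, d-1, ..., 2, 1), for d, k >= 1 *)

Definition socle_degree (d k : nat) : nat := (2 * d + k - 3)%N.

(* The truncated subtraction gives 0 beyond the socle degree. *)
Definition hilbT (d k i : nat) : nat :=
  if (i <= d - 1)%N then i.+1
  else if (i <= d + k - 2)%N then d
  else (socle_degree d k + 1 - i)%N.

(** * Graded quotients of R = K[x, y] *)

Section Quotients.
Variable K : fieldType.

(* R = K[x, y] and the ring E = K[X, Y] on which it acts are both represented
   by {mpoly K[2]}. *)
Local Notation R := {mpoly K[2]}.
Implicit Types (I : R -> Prop) (P : seq nat).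

(* [alpha] represents a K-basis of the image of the subspace V of R in the
   quotient R / I. *)
Definition basis_mod I (V : R -> Prop) (J : finType) (alpha : J -> R) : Prop :=
  [/\ forall u, V (alpha u),
      forall f, V f -> exists c : J -> K, I (f - \sum_u c u *: alpha u)
    & forall c : J -> K, I (\sum_u c u *: alpha u) -> forall u, c u = 0].

Definition graded_basis I (i : nat) (J : finType) (alpha : J -> R) : Prop :=
  basis_mod I (fun f => f \is i.-homog) alpha.

Definition has_hilbert_function I (T : nat -> nat) : Prop :=
  forall i, exists alpha : 'I_(T i) -> R, graded_basis I i alpha.

Definition ideal_gen2 (f g : R) : R -> Prop :=
  fun h => exists p q : R, h = p * f + q * g.

Definition regular_pair (f g : R) : Prop :=
  [/\ forall h, f * h = 0 -> h = 0,
      forall h, (exists p, g * h = p * f) -> exists q, h = q * f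
    & ~ ideal_gen2 f g 1].

(* As R has dimension 2, R / I is an Artinian complete intersection exactly
   when the regular sequence generating I has length 2. *)
Definition graded_artinian_CI I : Prop :=
  exists (m n : nat) (f g : R),
    [/\ f \is m.-homog, g \is n.-homog, regular_pair f g
      & forall h, I h <-> ideal_gen2 f g h].

(* The linear form a x + b y, where v = (a, b). *)
Definition linear_form (v : 'I_2 -> K) : R := \sum_(i < 2) v i *: 'X_i.

(* R / I has a K-basis made of the strings z_r, l z_r, ..., l^(p_r - 1) z_r
   with l^(p_r) z_r = 0, i.e. a Jordan basis for multiplication by l with
   (nilpotent) blocks of sizes p_0 >= p_1 >= ... *)
Definition is_jordan_type I (l : R) P : Prop :=
  is_partition P /\
  exists z : 'I_(size P) -> R,
    (forall r : 'I_(size P), I (l ^+ nth 0%N P r * z r)) /\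
    basis_mod I (fun _ => True)
      (fun q : {r : 'I_(size P) & 'I_(nth 0%N P r)} =>
         l ^+ tagged q * z (tag q)).

Definition is_CIJT (T : nat -> nat) P : Prop :=
  [/\ is_partition P, diag_length P =1 T
    & exists (I : R -> Prop) (v : 'I_2 -> K),
        [/\ graded_artinian_CI I, linear_form v != 0
          & is_jordan_type I (linear_form v) P]].

(** * Macaulay duality and Hessians *)

Definition diff_act (f F : R) : R := \sum_(m <- msupp f) f@_m *: F^`M[m].

Definition Ann (F : R) : R -> Prop := fun f => diff_act f F = 0.

Definition hessian (F : R) (n : nat) (alpha : 'I_n -> R) : R :=
  \det (\matrix_(u, w) diff_act (alpha u * alpha w) F).

End Quotients.

(* Main.v *)
From Stdlib Require Import Classical ClassicalEpsilon.
Require Import Defs.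
From HB Require Import structures.
From mathcomp Require Import all_boot all_order all_algebra zify ring.
From mathcomp Require Import ssrcomplements mpoly.

(* Write l for the linear form, w for a complementary one, j for the socle
   degree and I = Ann F. Let q_b be the least n such that l^n (w^b + l g) lies
   in I for some g, and choose e_b = w^b + l g with l^(q_b) e_b in I. The
   elements l^t e_b with t < q_b form a graded Jordan basis of R / I, so that
   P = (q_0, q_1, ...), because two Jordan bases have equally many elements
   l^t z with t >= n for each n.

   Let j - sigma b be the degree of the last element l^(q_b - 1) e_b of the
   b-th string. That element is killed by l and not by w^(sigma b), because
   the pairing (f, g) |-> (f g) o F is nondegenerate; since the socle of R / I
   is one-dimensional, sigma is a permutation of the rows of P. As q is
   nonincreasing, sigma (b + 1) >= sigma b - 1: sigma reverses the blocks of a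
   partition of the rows into intervals.

   The i-th Hessian does not vanish at l exactly when l^(j - 2i) is injective
   on the degree i part of R / I, that is, when sigma maps [0, i] to itself, so
   that a block ends at i. A difference-one hook with hand of degree j - i
   starts in the row b with sigma b = i, and its foot lies in a row r >= b with
   sigma r <= i + 1 <= sigma (r + 1). If a block ends at i, such rows are
   r = i and the last row of the next block, if there is one; otherwise r can
   only be the last row of the block of i. *)

Set Implicit Arguments.
Unset Strict Implicit.
Unset Printing Implicit Defensive.

Import GRing.Theory.

(** * Partitions given by a layered permutation *)

(** A sequence that falls by at most one per step cannot jump over a value: a step that crosses
    below [q] starts exactly at [q]. *)
Lemma unit_descent_ivt (f : nat -> nat) (q a c : nat) :
  a <= c -> (forall t, a <= t < c -> f t <= (f t.+1).+1) ->
  q <= f a -> f c < q ->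
  exists t, [/\ a <= t < c, f t = q & (f t.+1).+1 = q].
Proof.
move=> le_ac; rewrite -(subnKC le_ac); move: (c - a) => n {c le_ac}.
elim: n => [|n IHn] slow qa; first by rewrite addn0 ltnNge qa.
rewrite addnS => lt_q; have [lt_fn|le_fn] := ltnP (f (a + n)) q.
  have [|t [/andP[le_at lt_tn] ft ft1]] := IHn _ qa lt_fn.
    by move=> t /andP[le_at lt_tn]; apply: slow; rewrite le_at addnS leqW.
  by exists t; split=> //; rewrite le_at leqW.
have := slow (a + n); rewrite leq_addr addnS leqnn => /(_ isT) slow_n.
by exists (a + n); rewrite leq_addr leqnn; split=> //; lia.
Qed.

Lemma inj_below_surj (f : nat -> nat) (s : nat) :
  (forall b, b < s -> f b < s) ->
  (forall b c, b < s -> c < s -> f b = f c -> b = c) ->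
  forall c, c < s -> exists2 b, b < s & f b = c.
Proof.
move=> fs finj c lt_cs.
pose g (b : 'I_s) := Ordinal (fs b (ltn_ord b)).
have ginj : injective g by move=> x y [] /finj xy; apply/val_inj/xy.
exists (invF ginj (Ordinal lt_cs)); first by [].
by have /(congr1 val) := f_invF ginj (Ordinal lt_cs).
Qed.

Lemma hook_size_le (P : seq nat) (b : nat) :
  is_partition P -> nth 0 P b <= sumn P /\ size P <= sumn P.
Proof.
case/andP=> _ /allP P_gt0; split.
  elim: P b {P_gt0} => [|p P IHP] [|b] //=; first by rewrite leq_addr.
  by apply: leq_trans (IHP b) _; rewrite leq_addl.
elim: P P_gt0 => [|p P IHP] P_gt0 //=.
have p_gt0 := P_gt0 p (mem_head _ _).
rewrite -add1n leq_add ?IHP // => x xP.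
by apply: P_gt0; rewrite inE xP orbT.
Qed.

Lemma partition_nonincr (P : seq nat) (b c : nat) :
  is_partition P -> b <= c -> nth 0 P c <= nth 0 P b.
Proof.
case/andP=> P_sorted _ le_bc.
have [lt_c|le_c] := ltnP c (size P); last by rewrite nth_default.
have geq_trans : transitive geq by move=> x y z /= *; lia.
have geq_refl : reflexive geq by move=> x /=.
by apply: (sorted_leq_nth geq_trans geq_refl _ P_sorted); rewrite ?inE //; lia.
Qed.

Lemma partition_gt0 (P : seq nat) (b : nat) :
  is_partition P -> (0 < nth 0 P b) = (b < size P).
Proof.
case/andP=> _ /allP P_gt0; have [lt_b|le_b] := ltnP b (size P).
  exact/P_gt0/mem_nth.
by rewrite nth_default.
Qed.

(** Rows and columns of the diagram are initial segments, so only the ends of arm and leg have to be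
    tested, and [a] and [b] force [u]. *)
Lemma partition_hookE (P : seq nat) (a b u v : nat) : is_partition P ->
  is_hook P a b u v =
    [&& a < nth 0 P b, u == nth 0 P b - a, 0 < v,
        a < nth 0 P (b + v.-1) & nth 0 P (b + v) <= a].
Proof.
move=> Ppart; have nonincr := partition_nonincr Ppart.
apply/idP/idP.
  case/and5P=> u_gt0 v_gt0 /allP arm /allP leg; rewrite /in_CP -!leqNgt.
  case/andP=> armE legE.
  have /arm : 0 \in iota 0 u by rewrite mem_iota.
  have /arm : u.-1 \in iota 0 u by rewrite mem_iota; lia.
  have /leg : v.-1 \in iota 0 v by rewrite mem_iota; lia.
  by rewrite /in_CP addn0 => *; apply/and5P; split=> //; lia.
case/and5P=> lt_a /eqP -> v_gt0 lt_av le_av.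
apply/and5P; split; rewrite ?subn_gt0 //.
- by apply/allP=> t; rewrite mem_iota /in_CP; lia.
- apply/allP=> t; rewrite mem_iota /in_CP => lt_t.
  by apply: leq_trans lt_av _; apply: nonincr; lia.
- by rewrite /in_CP -!leqNgt le_av andbT; lia.
Qed.

(** Below degree [d] the value of [hilbT] counts all monomials of that degree, so the diagram misses
    none of them. *)
Lemma diag_length_full (P : seq nat) (d k i b : nat) :
  diag_length P =1 hilbT d k -> i < d -> b <= i -> i - b < nth 0 P b.
Proof.
move=> P_diag lt_id le_bi.
have cardE : #|[set b : 'I_i.+1 | in_CP P (i - b) b]| = i.+1.
  by rewrite -/(diag_length P i) P_diag /hilbT; have -> : i <= d - 1 by lia.
have /eqP/setP/(_ (Ordinal (le_bi : b < i.+1))) :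
    [set b : 'I_i.+1 | in_CP P (i - b) b] == setT.
  by rewrite eqEcard subsetT cardE cardsT card_ord leqnn.
by rewrite !inE.
Qed.

(** * Difference-one hooks in terms of the permutation [sigma] *)

Section LayeredPartition.

Variables (P : seq nat) (j : nat) (sigma : nat -> nat).
Hypothesis P_partition : is_partition P.
Local Notation s := (size P).
Hypothesis sigmaE : forall b, b < s -> nth 0 P b + b + sigma b = j.+1.
Hypothesis sigma_lt : forall b, b < s -> sigma b < s.
Hypothesis sigma_inj :
  forall b c, b < s -> c < s -> sigma b = sigma c -> b = c.

Lemma sigma_surj c : c < s -> exists2 b, b < s & sigma b = c.
Proof. exact: inj_below_surj. Qed.

Lemma sigma_slow b : b.+1 < s -> sigma b <= (sigma b.+1).+1.
Proof.
move=> lt_b; have := sigmaE lt_b; have := sigmaE (ltnW lt_b).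
have := partition_nonincr P_partition (leqnSn b); lia.
Qed.

Lemma sigma_socle b : b < s -> sigma b + b <= j.
Proof.
move=> lt_b; have := sigmaE lt_b; have := partition_gt0 b P_partition.
rewrite lt_b; lia.
Qed.

(* In the block decomposition of the layered permutation sigma, this says
   that no block contains both i and i + 1. *)
Definition block_end (i : nat) := forall b, b <= i -> sigma b <= i.

Lemma block_end_above i b :
  i < s -> block_end i -> i < b -> b < s -> i < sigma b.
Proof.
move=> lt_i stab lt_ib lt_b; rewrite ltnNge; apply/negP=> le_sb.
have [||c lt_c sc] := @inj_below_surj sigma i.+1 _ _ (sigma b) le_sb.
- by move=> c; rewrite ltnS => /stab.
- by move=> c e lt_c lt_e; apply: sigma_inj; apply: leq_trans lt_i.
by have := sigma_inj _ lt_b sc; lia.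
Qed.

(** Some row [b <= i] has its value above [i]; by counting, some row [c > i] has its value at most
    [i]. The slow descent from [b] to [c] steps from [i.+1] to [i]. *)
Lemma not_block_endP i : i < s -> ~ block_end i ->
  exists2 t, t.+1 < s & sigma t = i.+1 /\ sigma t.+1 = i.
Proof.
move=> lt_i not_stab.
have [b /andP[le_bi lt_isb]] : exists b, (b <= i) && (i < sigma b).
  have [/existsP[b lt_b]|/existsPn no_b] :=
    boolP [exists b : 'I_i.+1, i < sigma b].
    by exists b; rewrite lt_b -ltnS ltn_ord.
  case: not_stab => b le_b.
  by have := no_b (Ordinal (le_b : b < i.+1)); rewrite -leqNgt.
pose f (c : 'I_s) := Ordinal (sigma_lt (ltn_ord c)).
have f_inj : injective f by move=> x y [] /sigma_inj xy; apply/val_inj/xy.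
pose A := [set c : 'I_s | c <= i].
have [c fcA notAc] : exists2 c, f c \in A & c \notin A.
  (* Without such a [c], the preimage of [A] lies in [A] and has the same size, so it is [A], which
     [b] contradicts. *)
  apply/exists_inP; apply: contraTT lt_isb; rewrite negb_exists_in.
  move=> /forall_inP sub; have sub' : f @^-1: A \subset A.
    by apply/subsetP=> c; rewrite inE => /sub; rewrite negbK.
  have cardA : #|f @^-1: A| = #|A|.
    exact: on_card_preimset (onW_bij _ (injF_bij f_inj)).
  have /eqP eqA : f @^-1: A == A by rewrite eqEcard sub' cardA leqnn.
  have : Ordinal (leq_ltn_trans le_bi lt_i) \in A by rewrite inE.
  by rewrite -eqA !inE /= -leqNgt.
rewrite !inE /= -ltnNge in fcA notAc.
have [|||t [t_b st st1]] :=
    @unit_descent_ivt sigma i.+1 b c _ _ lt_isb; rewrite ?ltnS //.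
- by lia.
- by move=> t t_b; apply: sigma_slow; have := ltn_ord c; lia.
exists t; last by case: st1.
by have := ltn_ord c; lia.
Qed.

(* Since u - v = 1, the foot x^a y^r of a hook with hand of degree j - i has
   degree j - i - 1; its existence in column a is a condition on sigma r and
   sigma (r + 1) only. *)
Definition foot_row (i b r : nat) :=
  [/\ b <= r < s, sigma r <= i.+1, r.+1 < s -> i < sigma r.+1
    & r.+1 = s -> i + s <= j].

(** Here [nth 0 P b = j.+1 - b - i], so in column [j - i - r.+1] the arm has length [(r - b).+2],
    one more than the leg that ends in row [r]. *)
Lemma foot_row_hook i b r : sigma b = i -> foot_row i b r ->
  let a := j - i - r.+1 in
  [/\ is_hook P a b (r - b).+2 (r - b).+1, hand_degree a b (r - b).+2 = j - i
    & [/\ a <= sumn P, b <= sumn P, (r - b).+2 <= sumn P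
        & (r - b).+1 <= sumn P]].
Proof.
move=> sb [/andP[le_br lt_r] le_sr lt_sr1 le_last] a.
have lt_b := leq_ltn_trans le_br lt_r.
have Eb := sigmaE lt_b; have Er := sigmaE lt_r.
have nonincr := partition_nonincr P_partition le_br.
have [sz1 sz2] := hook_size_le b P_partition.
have p_b := partition_gt0 b P_partition.
have p_r := partition_gt0 r P_partition.
(* The subtraction in [a] is not truncated: above the last row by [sigma_socle] at [r.+1], in the
   last row by the final clause of [foot_row]. *)
have next : [/\ nth 0 P r.+1 <= a, r.+1 + i <= j & a + r.+1 + i = j].
  have [lt_r1|le_r1] := ltnP r.+1 s.
    have := sigmaE lt_r1; have := lt_sr1 lt_r1; have := sigma_socle lt_r1.
    by rewrite /a; split; lia.
  have r1s : r.+1 = s by lia.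
  by have := le_last r1s; rewrite nth_default // /a; split; lia.
case: next => le_pr1 le_j aE.
rewrite lt_b lt_r in p_b p_r.
split; last by split; lia.
  rewrite partition_hookE // succnK.
  have -> : b + (r - b) = r by lia.
  have -> : b + (r - b).+1 = r.+1 by lia.
  by apply/and5P; split; lia.
by rewrite /hand_degree /=; lia.
Qed.

Lemma hook_foot_row i a b u v : i < s ->
  is_hook P a b u v -> u = v.+1 -> hand_degree a b u = j - i ->
  [/\ b < s, sigma b = i, u = (b + v.-1 - b).+2, v = (b + v.-1 - b).+1
    & a = j - i - (b + v.-1).+1 /\ foot_row i b (b + v.-1)].
Proof.
move=> lt_i; rewrite partition_hookE //.
case/and5P=> lt_a /eqP uE v_gt0 lt_av le_av uv; rewrite /hand_degree => hd.
have lt_b : b < s by rewrite -partition_gt0 //; lia.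
have lt_r : b + v.-1 < s by rewrite -partition_gt0 //; lia.
(* A row with value [i] shows [i <= j], so the hand degree [j - i] is exact and determines
   [sigma b]. *)
have [c lt_c sc] := sigma_surj lt_i; have := sigma_socle lt_c.
have Eb := sigmaE lt_b; have Er := sigmaE lt_r.
have sb : sigma b = i by have := sigma_socle lt_c; lia.
split; rewrite ?sb //; try lia.
split; first lia.
have rE : b + v = (b + v.-1).+1 by lia.
split; [lia|lia| |].
  by move=> lt_r1; have := sigmaE lt_r1; rewrite -rE; lia.
by move=> r1s; rewrite rE nth_default in le_av; lia.
Qed.

Definition encode_hook (N : nat) (h : nat * nat * nat * nat) :
    'I_N.+1 * 'I_N.+1 * 'I_N.+1 * 'I_N.+1 :=
  let: (a, b, u, v) := h in (inord a, inord b, inord u, inord v).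

Definition diff_one_hook_set (i : nat) :
    {set 'I_(sumn P).+1 * 'I_(sumn P).+1 * 'I_(sumn P).+1 * 'I_(sumn P).+1} :=
  [set h : 'I_(sumn P).+1 * 'I_(sumn P).+1 * 'I_(sumn P).+1 * 'I_(sumn P).+1 |
     let: (a, b, u, v) := h in
     [&& is_hook P a b u v, u == v.+1 :> nat & hand_degree a b u == j - i]].

Lemma foot_row_mem i b r : sigma b = i -> foot_row i b r ->
  encode_hook (sumn P) (j - i - r.+1, b, (r - b).+2, (r - b).+1)
    \in diff_one_hook_set i.
Proof.
move=> sb br; have [hook hd [a_le b_le u_le v_le]] := foot_row_hook sb br.
by rewrite inE /encode_hook !inordK ?ltnS // hook hd !eqxx.
Qed.

Lemma mem_foot_row i h : i < s -> h \in diff_one_hook_set i ->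
  exists b r, [/\ b < s, sigma b = i, foot_row i b r
    & h = encode_hook (sumn P) (j - i - r.+1, b, (r - b).+2, (r - b).+1)].
Proof.
case: h => [[[a b] u] v] lt_i; rewrite inE => /and3P[hook /eqP uv /eqP hd].
have [lt_b sb uE vE [aE br]] := hook_foot_row lt_i hook uv hd.
exists b, (b + v.-1); split=> //; rewrite /encode_hook -aE -uE -vE.
by congr (_, _, _, _); apply/val_inj; rewrite /= inordK.
Qed.

(** The two feet lie in row [i] and in the row that [sigma] sends to [i.+1]; the hooks are told
    apart by their leg lengths. *)
Lemma block_end_two_hooks i : i.+1 < s -> block_end i ->
  1 < diff_one_hooks P (j - i).
Proof.
move=> lt_i1 stab; have lt_i := ltnW lt_i1.
have [b lt_b sb] := sigma_surj lt_i; have [r lt_r sr] := sigma_surj lt_i1.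
have above := block_end_above lt_i stab.
have le_bi : b <= i by rewrite leqNgt; apply/negP=> /above/(_ lt_b); lia.
have lt_ir : i < r by rewrite ltnNge; apply/negP=> /stab; lia.
have foot1 : foot_row i b i.
  split; rewrite ?le_bi ?lt_i //; first by apply: leqW; apply: stab.
    by move=> lt; apply: above.
  by move=> E; rewrite E ltnn in lt_i1.
have foot2 : foot_row i b r.
  split; [lia|lia| |].
    by move=> lt; apply: above => //; lia.
  by move=> E; have := sigma_socle lt_r; lia.
apply/card_gt1P.
exists (encode_hook (sumn P) (j - i - i.+1, b, (i - b).+2, (i - b).+1)).
exists (encode_hook (sumn P) (j - i - r.+1, b, (r - b).+2, (r - b).+1)).
split; try exact: foot_row_mem.
have [_ _ [_ _ _ le1]] := foot_row_hook sb foot1.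
have [_ _ [_ _ _ le2]] := foot_row_hook sb foot2.
by apply/eqP=> /(congr1 (fun h => val h.2)); rewrite /= !inordK ?ltnS //; lia.
Qed.

Lemma last_block_end_hook i : i.+1 = s -> i + s <= j ->
  0 < diff_one_hooks P (j - i).
Proof.
move=> i1s le_j; have lt_i : i < s by rewrite -i1s.
have [b lt_b sb] := sigma_surj lt_i.
have foot : foot_row i b i.
  by split=> //; [lia | have := sigma_lt lt_i; lia | lia].
apply/card_gt0P.
exists (encode_hook (sumn P) (j - i - i.+1, b, (i - b).+2, (i - b).+1)).
exact: foot_row_mem.
Qed.

(** The value [i.+1] is taken in the row just above [b], hence in no row from [b] on. A later row
    with value at most [i] would force the slow descent from row [r.+1], whose value exceeds [i], to
    take it again. *)
Lemma not_block_end_foot_row i b r r' : i < s -> ~ block_end i ->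
  sigma b = i -> foot_row i b r -> r < r' < s -> i.+1 < sigma r'.
Proof.
move=> lt_i /(not_block_endP lt_i)[t lt_t [st st1]] sb.
case=> /andP[le_br lt_r] le_sr lt_sr1 _ /andP[lt_rr' lt_r'].
have bE : b = t.+1.
  by apply: sigma_inj; rewrite ?st1 //; apply: leq_ltn_trans le_br lt_r.
rewrite ltnNge; apply/negP=> le_sr'.
have neq c : b <= c < s -> sigma c <> i.+1.
  by move=> c_b; rewrite -st => /sigma_inj; lia.
have lt_r1 : r.+1 < s by lia.
have sr1 : i.+1 <= sigma r.+1 by apply: lt_sr1.
have sr' : sigma r' < i.+1 by have := @neq r'; lia.
have [|c [c_r sc _]] := @unit_descent_ivt sigma i.+1 r.+1 r' lt_rr' _ sr1 sr'.
  by move=> c c_r; apply: sigma_slow; lia.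
by apply: (@neq c) => //; lia.
Qed.

Lemma not_block_end_one_hook i : i < s -> ~ block_end i ->
  diff_one_hooks P (j - i) < 2.
Proof.
move=> lt_i not_stab; rewrite ltnS; apply/card_le1_eqP=> h h'.
move=> /(mem_foot_row lt_i)[b [r [lt_b sb br ->]]].
move=> /(mem_foot_row lt_i)[b' [r' [lt_b' sb' br' ->]]].
have bb' : b' = b by apply: sigma_inj; rewrite ?sb.
rewrite bb' in br' *.
have foot r1 r2 := @not_block_end_foot_row i b r1 r2 lt_i not_stab sb.
have [lt_rr'|lt_r'r|->//] := ltngtP r r'.
  have := foot _ r' br; have [/andP[_ lt_r'] le_sr' _ _] := br'.
  by rewrite lt_rr' lt_r' => /(_ isT); lia.
have := foot _ r br'; have [/andP[_ lt_r] le_sr _ _] := br.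
by rewrite lt_r'r lt_r => /(_ isT); lia.
Qed.

(** As the last row has value at most [i], the foot must lie there, and then the column of the hook
    would be negative. *)
Lemma not_block_end_no_hook i : i < s -> ~ block_end i ->
  sigma s.-1 <= i -> j < i + s -> diff_one_hooks P (j - i) = 0.
Proof.
move=> lt_i not_stab le_last lt_j; apply/eqP; rewrite cards_eq0 -/(diff_one_hook_set i).
apply/set0Pn=> -[h /(mem_foot_row lt_i)[b [r [lt_b sb br _]]]].
have := @not_block_end_foot_row i b r s.-1 lt_i not_stab sb br.
by case: br => [/andP[_ lt_r] _ _ last]; have := last; lia.
Qed.

(** * Consequences of the diagonal lengths [T] *)

Variables (d k : nat).
Hypotheses (d_gt0 : 0 < d) (k_gt0 : 0 < k) (jE : j = socle_degree d k).
Hypothesis P_diag : diag_length P =1 hilbT d k.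

(** The row with value [s.-1] has its hand in the least degree, [j - s.-1]. Full diagonals below [d]
    bound [s] on both sides; for [s] strictly between the two values all monomials of degree [d]
    would lie in the diagram, against [hilbT d k d = d]. *)
Lemma size_layered : s = d \/ s = d + k - 1.
Proof.
have dE : socle_degree d k = 2 * d + k - 3 by [].
have le_ds : d <= s.
  have := diag_length_full (i := d.-1) (b := d.-1) P_diag.
  by rewrite subnn partition_gt0 //; lia.
have le_sdk : s <= d + k - 1.
  rewrite leqNgt; apply/negP=> lt_s.
  have lt_s1 : s.-1 < s by lia.
  have [b lt_b sb] := sigma_surj lt_s1.
  have := sigmaE lt_b; have := sigma_socle lt_b.
  by have := diag_length_full (i := d.-1) (b := b) P_diag; lia.
have [->|neq_sd] := eqVneq s d; [by left | right].
apply/eqP; rewrite eqn_leq le_sdk leqNgt; apply/negP=> lt_s.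
have : diag_length P d != d.+1.
  rewrite P_diag /hilbT; have -> : (d <= d - 1) = false by lia.
  have -> : d <= d + k - 2 by lia.
  by rewrite neq_ltn ltnSn.
case/eqP; apply/eqP; rewrite /diag_length.
have -> : [set b : 'I_d.+1 | in_CP P (d - b) b] = setT.
  apply/setP=> -[b /= le_b]; rewrite !inE /in_CP /=.
  have lt_b : b < s by lia.
  by have := sigmaE lt_b; have := sigma_lt lt_b; lia.
by rewrite cardsT card_ord.
Qed.

Lemma block_end_hooks i : i.+1 < d ->
  ~ block_end i <-> diff_one_hooks P (j - i) < 2.
Proof.
move=> lt_id; have lt_is : i.+1 < s by case: size_layered => ->; lia.
split=> [|hooks stab]; first exact: not_block_end_one_hook (ltnW lt_is).
by have := block_end_two_hooks lt_is stab; lia.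
Qed.

Lemma block_end_top_hooks : 1 < k ->
  ~ block_end (d - 1) <-> diff_one_hooks P (j - (d - 1)) < 1.
Proof.
have dE : socle_degree d k = 2 * d + k - 3 by [].
(* If [s = d], then [d - 1] is the last row and its hook exists because [d - 1 + s <= j] when
   [k >= 2]. If [s = d + k - 1], then [sigma_socle] makes the value of the last row at most [d - 1],
   and [d - 1 + s = j.+1]. *)
move=> k_gt1; case: size_layered => sE.
  have stab : block_end (d - 1).
    by move=> b le_b; have := @sigma_lt b; lia.
  have := @last_block_end_hook (d - 1); split=> //; lia.
have last : sigma s.-1 <= d - 1.
  by have := @sigma_socle s.-1; lia.
have not_stab : ~ block_end (d - 1).
  move=> /(@block_end_above (d - 1) s.-1); lia.
split=> // _; rewrite not_block_end_no_hook //; lia.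
Qed.

End LayeredPartition.

Local Open Scope ring_scope.

(** * The action of R by differentiation *)

Lemma dhomog_ind (n : nat) (R : nzRingType) (Q : {mpoly R[n]} -> Prop) (i : nat) :
  Q 0 -> (forall a f g, Q f -> Q g -> Q (a *: f + g)) ->
  (forall m, mdeg m = i -> Q 'X_[m]) -> forall f, f \is i.-homog -> Q f.
Proof.
move=> Q0 QD QX f /dhomogP homf; rewrite [f]mpolyE big_seq.
by elim/big_rec: _ => // m g /homf /QX Qm; apply: QD.
Qed.

Section DiffAct.

Variable K : fieldType.
Local Notation R := {mpoly K[2]}.
Implicit Types (f g F G : R) (v : 'I_2 -> K).

(** A fixed index set replaces the support of [f], so that additivity in [f] can be checked
    termwise. *)
Lemma diff_actwE k f F : (msize f <= k)%N ->
  diff_act f F = \sum_(m : 'X_{1..2 < k}) f@_m *: F^`M[m].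
Proof.
move=> le_fk; pose I : subFinType _ := 'X_{1..2 < k}.
rewrite /diff_act (big_mksub I) /=; first last.
- by move=> m /msize_mdeg_lt /leq_trans; apply.
- exact: msupp_uniq.
by rewrite big_rmcond //= => m /memN_msupp_eq0 ->; rewrite scale0r.
Qed.

Lemma diff_actP a f g F : diff_act (a *: f + g) F = a *: diff_act f F + diff_act g F.
Proof.
pose k := maxn (msize f) (maxn (msize g) (msize (a *: f + g))).
rewrite !(@diff_actwE k) /k ?leq_max ?leqnn ?orbT //.
rewrite scaler_sumr -big_split; apply: eq_bigr => m _ /=.
by rewrite mcoeffD mcoeffZ scalerDl scalerA.
Qed.

Definition diff_actl F f : R := diff_act f F.

Lemma diff_actl_is_linear F : linear (diff_actl F).
Proof. by move=> a f g; apply: diff_actP. Qed.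

HB.instance Definition _ F :=
  GRing.isLinear.Build K R R _ (diff_actl F) (diff_actl_is_linear F).

Lemma diff_act_suml (J : Type) (r : seq J) (A : pred J) (f : J -> R) F :
  diff_act (\sum_(u <- r | A u) f u) F = \sum_(u <- r | A u) diff_act (f u) F.
Proof. by rewrite -[LHS]/(diff_actl F _) linear_sum. Qed.

Lemma diff_actZl a f F : diff_act (a *: f) F = a *: diff_act f F.
Proof. by rewrite -[LHS]/(diff_actl F _) linearZ. Qed.

Lemma diff_actPr f a F G : diff_act f (a *: F + G) = a *: diff_act f F + diff_act f G.
Proof.
rewrite /diff_act scaler_sumr -big_split; apply: eq_bigr => m _ /=.
by rewrite linearP scalerDr !scalerA mulrC.
Qed.

Lemma diff_act_is_linearr f : linear (diff_act f).
Proof. by move=> a F G; rewrite diff_actPr. Qed.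

HB.instance Definition _ f :=
  GRing.isLinear.Build K R R _ (diff_act f) (diff_act_is_linearr f).

Lemma diff_actX m F : diff_act 'X_[m] F = F^`M[m].
Proof. by rewrite /diff_act msuppX big_seq1 mcoeffX eqxx scale1r. Qed.

Lemma diff_actM f g F : diff_act (f * g) F = diff_act f (diff_act g F).
Proof.
rewrite [f]mpolyE [g]mpolyE mulr_suml !diff_act_suml.
apply: eq_bigr => m _; rewrite mulr_sumr diff_act_suml.
rewrite linear_sum /=; apply: eq_bigr => m' _.
rewrite -scalerAl -scalerAr -mpolyXD !diff_actZl.
by rewrite !diff_actX addmC mderivmDm mderivmZ !scalerA mulrC.
Qed.

(** The vanishing is stated separately because [j - mdeg m] is truncated to 0 when [j < mdeg m]. *)
Lemma mderivm_homog m j F : F \is j.-homog ->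
  F^`M[m] \is (j - mdeg m).-homog /\ ((j < mdeg m)%N -> F^`M[m] = 0).
Proof.
move=> /dhomogP homF.
have degE m' : m' \in msupp F^`M[m] -> (mdeg m + mdeg m')%N = j.
  rewrite mcoeff_msupp mcoeff_mderivm -mdegD => nz.
  by apply: homF; rewrite mcoeff_msupp; apply: contraNneq nz => ->; rewrite mul0rn.
split; first by apply/dhomogP=> m' /degE <-; rewrite addKn.
move=> lt_j; apply/eqP; rewrite -msupp_eq0.
by case: (msupp _) degE => // m' s /(_ m' (mem_head _ _)); lia.
Qed.

Lemma diff_act_homog i j f F : f \is i.-homog -> F \is j.-homog ->
  diff_act f F \is (j - i).-homog.
Proof.
move=> /dhomogP homf homF; rewrite /diff_act big_seq.
apply: rpred_sum => m /homf <-; apply: rpredZ.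
by case: (mderivm_homog m homF).
Qed.

Lemma diff_act_gt_degree i j f F : f \is i.-homog -> F \is j.-homog ->
  (j < i)%N -> diff_act f F = 0.
Proof.
move=> /dhomogP homf homF lt_ji; rewrite /diff_act big_seq big1 // => m /homf degm.
by case: (mderivm_homog m homF) => _ ->; rewrite ?scaler0 // degm.
Qed.

(** [Ann F] is a homogeneous ideal: the components of [f] of degree at most [j] send [F] to distinct
    degrees, and the others kill it. *)
Lemma diff_act_pihomog j F f i : F \is j.-homog ->
  diff_act f F = 0 -> diff_act (pihomog mdeg i f) F = 0.
Proof.
move=> homF f0; have homi i' := pihomogP mdeg i' f.
have [lt_ji|le_ij] := ltnP j i; first exact: diff_act_gt_degree (homi i) homF lt_ji.
rewrite (@pihomog_partitionE _ _ mdeg (maxn i.+1 (msize f)) f) ?leq_maxr // in f0.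
have lt_i : (i < maxn i.+1 (msize f))%N by rewrite leq_max leqnn.
rewrite diff_act_suml (bigD1 (Ordinal lt_i)) //= in f0.
move/(congr1 (pihomog mdeg (j - i))): f0.
rewrite pihomog0 pihomogD pihomog_dE ?diff_act_homog //.
rewrite raddf_sum /= big1 ?addr0 // => i' ne_i'.
have [lt_ji'|le_i'j] := ltnP j i'.
  by rewrite (diff_act_gt_degree (homi i') homF lt_ji') pihomog0.
apply: pihomog_ne0 (diff_act_homog (homi i') homF).
by apply: contraNneq ne_i' => E; apply/eqP/val_inj => /=; lia.
Qed.

Lemma linear_form_homog v : linear_form v \is 1.-homog.
Proof. by apply: rpred_sum => i _; apply: rpredZ; rewrite dhomogX /= mdeg1. Qed.

Lemma diff_act_linear_form v G :
  diff_act (linear_form v) G = \sum_(i < 2) v i *: G^`M(i).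
Proof.
rewrite /linear_form diff_act_suml; apply: eq_bigr => i _.
by rewrite diff_actZl diff_actX mderivmU1m.
Qed.

Lemma euler_identity v n G : G \is n.-homog ->
  (diff_act (linear_form v) G).@[v] = n%:R * G.@[v].
Proof.
apply: (dhomog_ind (Q := fun G => _ = _ * G.@[v])) => [|a f g Ef Eg|m degm].
- by rewrite linear0 meval0 mulr0.
- by rewrite linearP /= !mevalD !mevalZ Ef Eg; ring.
rewrite diff_act_linear_form raddf_sum /= -degm mdegE natr_sum mulr_suml.
apply: eq_bigr => i _; rewrite mderivX !mevalZ.
have [->|mi_neq0] := eqVneq (m i) 0%N; first by rewrite !mul0r mulr0.
rewrite mulrCA; congr (_ * _); rewrite -[v i](mevalXU v) -mevalM -mpolyXD.
by rewrite addmC submK // lep1mP.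
Qed.

(** Iterated Euler identity; it turns the value of a form at [v] into the action of a power of
    [l]. *)
Lemma diff_act_linear_form_exp v n G : G \is n.-homog ->
  (diff_act (linear_form v ^+ n) G).@[v] = (n`!)%:R * G.@[v].
Proof.
elim: n G => [|n IHn] G homG.
  by rewrite expr0 -(@mpolyX0 2 K) diff_actX mderivm0m mul1r.
rewrite exprSr diff_actM IHn; last first.
  by have := diff_act_homog (linear_form_homog v) homG; rewrite subn1.
by rewrite (euler_identity v homG) mulrA -natrM factS mulnC.
Qed.

Lemma dhomog0_eval0 v G : G \is 0.-homog -> G.@[v] = 0 -> G = 0.
Proof.
move=> homG; suff -> : G = (G@_0)%:MP by rewrite mevalC => ->.
apply/mpolyP=> m; rewrite mcoeffC; have [<-|ne_m] := eqVneq 0%MM m.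
  by rewrite mulr1.
by rewrite mulr0; apply: dhomog_nemf_coeff homG _; rewrite mdeg_eq0 eq_sym.
Qed.

Hypothesis charK0 : [pchar K] =i pred0.

(** Differentiating by a monomial [m] of degree [n] leaves its coefficient times a product of
    factorials, which is nonzero in characteristic 0. *)
Lemma diff_act_nondegenerate n G : G \is n.-homog ->
  (forall f, f \is n.-homog -> diff_act f G = 0) -> G = 0.
Proof.
move=> homG G0; apply/mpolyP=> m; rewrite mcoeff0.
have [degm|ne_m] := eqVneq (mdeg m) n; last exact: dhomog_nemf_coeff homG ne_m.
have := G0 'X_[m]; rewrite dhomogX /= degm eqxx diff_actX => /(_ isT).
move/(congr1 (mcoeff 0)); rewrite mcoeff_mderivm addm0 mcoeff0 -mulr_natr => /eqP.
rewrite mulf_eq0 => /orP[/eqP->//|]; rewrite (pcharf0P K).1 // => fact0.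
suff : (0 < \prod_(i < 2) (m i) ^_ (m i))%N by rewrite (eqP fact0).
by rewrite prodn_gt0 // => i; rewrite ffactnn fact_gt0.
Qed.

End DiffAct.

(** * Uniqueness of the Jordan type *)

Section SpanModulo.

Variables (K : fieldType) (V : lmodType K) (I : V -> Prop).
Hypothesis I0 : I 0.
Hypothesis ID : forall a u v, I u -> I v -> I (a *: u + v).

Definition span_mod (J : finType) (B : {pred J}) (beta : J -> V) (f : V) : Prop :=
  exists c : J -> K, I (f - \sum_(w in B) c w *: beta w).

Lemma span_mod_comb (J : finType) (B : {pred J}) (beta : J -> V) a f g :
  span_mod B beta f -> span_mod B beta g -> span_mod B beta (a *: f + g).
Proof.
move=> [c Ic] [e Ie]; exists (fun w => a * c w + e w).
have -> : \sum_(w in B) (a * c w + e w) *: beta w =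
    a *: \sum_(w in B) c w *: beta w + \sum_(w in B) e w *: beta w.
  rewrite scaler_sumr -big_split; apply: eq_bigr => w _ /=.
  by rewrite scalerDl scalerA.
by rewrite opprD addrACA -scalerBr; apply: ID.
Qed.

Lemma span_mod_in (J : finType) (B : {pred J}) (beta : J -> V) f :
  I f -> span_mod B beta f.
Proof.
by move=> If; exists (fun=> 0); rewrite big1 ?subr0 // => w _; rewrite scale0r.
Qed.

Lemma span_mod_elem (J : finType) (B : {pred J}) (beta : J -> V) w :
  w \in B -> span_mod B beta (beta w).
Proof.
move=> Bw; exists (fun w' => (w' == w)%:R); rewrite (bigD1 w) //= eqxx scale1r.
rewrite big1 ?addr0 ?subrr // => w' /andP[_ /negbTE->].
by rewrite scale0r.
Qed.

Lemma span_mod_sum (J J' : finType) (B : {pred J}) (beta : J -> V)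
    (A : {pred J'}) (a : J' -> K) (f : J' -> V) :
  (forall u, u \in A -> span_mod B beta (f u)) ->
  span_mod B beta (\sum_(u in A) a u *: f u).
Proof.
move=> spf; elim/big_rec: _ => [|u g Au]; first exact: span_mod_in.
by apply: span_mod_comb; apply: spf.
Qed.

Definition free_mod (J : finType) (A : {pred J}) (alpha : J -> V) : Prop :=
  forall c : J -> K, I (\sum_(u in A) c u *: alpha u) ->
  forall u, u \in A -> c u = 0.

Lemma I_sum (J : finType) (A : {pred J}) (c : J -> K) (f : J -> V) :
  (forall u, u \in A -> I (f u)) -> I (\sum_(u in A) c u *: f u).
Proof. by move=> If; elim/big_rec: _ => // u g Au; apply/ID/If. Qed.

(** Steinitz bound modulo [I]: if [A] were larger than [B], the coefficient matrix would have a
    nonzero left kernel vector, which is a relation among the [alpha]. *)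
Lemma card_free_le_span (J J' : finType) (A : {pred J}) (B : {pred J'})
    (alpha : J -> V) (beta : J' -> V) :
  free_mod A alpha -> (forall u, u \in A -> span_mod B beta (alpha u)) ->
  (#|A| <= #|B|)%N.
Proof.
move=> freeA spanA; rewrite leqNgt; apply/negP=> lt_BA.
have [e Ie] := fin_all_exists (fun i : 'I_#|A| => spanA _ (enum_valP i)).
pose M := \matrix_(i < #|A|, k < #|B|) e i (enum_val k).
have /rowV0Pn[y /sub_kermxP yM] : kermx M != 0.
  rewrite kermx_eq0 /row_free neq_ltn; apply/orP; left.
  exact: leq_ltn_trans (rank_leq_col _) lt_BA.
case/eqP; apply/rowP=> i0; rewrite mxE.
pose u0 := enum_val i0; have Au0 : u0 \in A := enum_valP i0.
pose c u := y 0 (enum_rank_in Au0 u).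
have cE i : c (enum_val i) = y 0 i by rewrite /c enum_valK_in.
suff /freeA/(_ u0 Au0) : I (\sum_(u in A) c u *: alpha u) by rewrite cE.
rewrite big_enum_val /=.
have -> : \sum_(i < #|A|) c (enum_val i) *: alpha (enum_val i) =
    \sum_(i in 'I_#|A|) y 0 i *: (alpha (enum_val i) - \sum_(w in B) e i w *: beta w).
  have -> : \sum_(i in 'I_#|A|)
        y 0 i *: (alpha (enum_val i) - \sum_(w in B) e i w *: beta w)
    = \sum_(i < #|A|) y 0 i *: alpha (enum_val i)
      - \sum_(i < #|A|) y 0 i *: (\sum_(w in B) e i w *: beta w).
    by rewrite -sumrB; apply: eq_bigr => i _; rewrite scalerBr.
  rewrite [X in _ - X](_ : _ = 0) ?subr0; first by apply: eq_bigr => i _; rewrite cE.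
  transitivity (\sum_(w in B) (\sum_i y 0 i * e i w) *: beta w).
    under eq_bigr do rewrite scaler_sumr; rewrite exchange_big /=.
    by apply: eq_bigr => w _; rewrite scaler_suml; apply: eq_bigr => i _; rewrite scalerA.
  rewrite big_enum_val big1 // => k _.
  have /rowP/(_ k) := yM; rewrite !mxE => yMk.
  rewrite (_ : \sum_i _ = 0) ?scale0r // -[RHS]yMk.
  by apply: eq_bigr => i _; rewrite mxE.
exact: I_sum.
Qed.

End SpanModulo.

Section JordanStrings.

Variables (K : fieldType).
Local Notation R := {mpoly K[2]}.
Variables (I : R -> Prop) (l : R).
Hypothesis I0 : I 0.
Hypothesis ID : forall a u v, I u -> I v -> I (a *: u + v).
Hypothesis IM : forall u v, I v -> I (u * v).

Definition string_elem (s : nat) (p : 'I_s -> nat) (z : 'I_s -> R)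
  (q : {r : 'I_s & 'I_(p r)}) : R := l ^+ tagged q * z (tag q).

Definition jordan_strings (s : nat) (p : 'I_s -> nat) (z : 'I_s -> R) : Prop :=
  (forall r, I (l ^+ p r * z r)) /\
  basis_mod I (fun=> True) (@string_elem s p z).

Lemma string_in (p n : nat) z : I (l ^+ p * z) -> (p <= n)%N -> I (l ^+ n * z).
Proof. by move=> Ip le_pn; rewrite -(subnK le_pn) exprD -mulrA; apply: IM. Qed.

Lemma string_span s p z (n t : nat) (r : 'I_s) : I (l ^+ p r * z r) -> (n <= t)%N ->
  span_mod I [pred q : {r : 'I_s & 'I_(p r)} | n <= tagged q]%N
    (@string_elem s p z) (l ^+ t * z r).
Proof.
move=> Ir le_nt; have [lt_t|le_t] := ltnP t (p r); last first.
  by apply: span_mod_in => //; apply: string_in le_t.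
pose q : {r : 'I_s & 'I_(p r)} := Tagged (fun r => 'I_(p r)) (Ordinal lt_t).
by rewrite -[_ * _]/(string_elem z q); apply: span_mod_elem.
Qed.

(* The string elements l^t z_r with t >= n are a basis of l^n (R / I). *)
Lemma jordan_strings_tail_le s p z s' p' z' (n : nat) :
  @jordan_strings s p z -> @jordan_strings s' p' z' ->
  (#|[pred q : {r : 'I_s & 'I_(p r)} | n <= tagged q]| <=
   #|[pred q : {r : 'I_s' & 'I_(p' r)} | n <= tagged q]|)%N.
Proof.
move=> [Iz [_ _ free_z]] [Iz' [_ span_z' _]].
apply: (card_free_le_span I0 ID (alpha := @string_elem s p z)
  (beta := @string_elem s' p' z')).
  move=> c Ic q Aq.
  (* Extension by zero turns a relation on the tail into one on the whole basis. *)
  pose c' (q : {r : 'I_s & 'I_(p r)}) := if (n <= tagged q)%N then c q else 0.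
  suff : c' q = 0 by rewrite /c'; move: Aq; rewrite inE => ->.
  apply: free_z.
  rewrite (bigID [pred q : {r : 'I_s & 'I_(p r)} | n <= tagged q]%N) /=.
  rewrite [X in _ + X]big1 ?addr0.
    by rewrite (eq_bigr (fun q => c q *: string_elem z q)) // => q' Aq'; rewrite /c' Aq'.
  by move=> q' /negbTE nAq'; rewrite /c' nAq' scale0r.
case=> r t; rewrite inE /= => le_n.
(* The cofactor of [l ^+ n] is expanded in the other basis; multiplying back by [l ^+ n] moves each
   term into the tail. *)
have [c Ic] := span_z' (l ^+ (t - n) * z r) Logic.I.
rewrite /string_elem /= -(subnKC le_n) exprD -mulrA.
pose g := \sum_(q' : {r : 'I_s' & 'I_(p' r)})
  c q' *: (l ^+ (n + tagged q') * z' (tag q')).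
rewrite -[l ^+ n * _](subrK g) -[_ - g]scale1r; apply: span_mod_comb => //.
  apply: span_mod_in => //; rewrite /g.
  have -> : \sum_(q' : {r : 'I_s' & 'I_(p' r)})
        c q' *: (l ^+ (n + tagged q') * z' (tag q'))
      = l ^+ n * \sum_q' c q' *: string_elem z' q'.
    by rewrite mulr_sumr; apply: eq_bigr => q' _; rewrite -scalerAr exprD mulrA.
  by rewrite -mulrBr; apply: IM.
apply: span_mod_sum => // q' _; apply: string_span => //; exact: leq_addr.
Qed.

Lemma card_string_tail s (p : 'I_s -> nat) (n : nat) :
  #|[pred q : {r : 'I_s & 'I_(p r)} | n <= tagged q]%N| = (\sum_r (p r - n))%N.
Proof.
rewrite -sum1_card.
rewrite -(sig_big_dep predT (fun r (t : 'I_(p r)) => n <= t)%N (fun _ _ => 1%N)) /=.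
apply: eq_bigr => r _; rewrite -(big_mkord (fun t => n <= t)%N (fun=> 1%N)).
have [le_np|lt_pn] := leqP n (p r); last first.
  rewrite big_nat_cond big1 => [|t]; first by apply/esym/eqP; rewrite subn_eq0 ltnW.
  lia.
rewrite (big_cat_nat (n := n)) //= big_nat_cond big1 ?add0n; last by move=> t; lia.
rewrite big_nat_cond (eq_bigl (fun t => n <= t < p r)%N) => [|t]; last by lia.
by rewrite -big_nat sum_nat_const_nat muln1.
Qed.

(** The indices with [n < f r] form an initial segment, whose length is a part of the conjugate
    partition. *)
Lemma nonincr_count (f : nat -> nat) (m n b : nat) :
  (forall b c, b <= c -> f c <= f b)%N -> (forall b, m <= b -> f b = 0)%N ->
  (n < f b)%N = (b < \sum_(r < m) (n < f r))%N.
Proof.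
move=> nonincr f0; have cnt k : (k <= m)%N ->
    (\sum_(r < m) (n < f r) =
     \sum_(0 <= r < k) (n < f r) + \sum_(k <= r < m) (n < f r))%N.
  move=> le_k.
  by rewrite -(big_mkord xpredT (fun r => (n < f r) : nat)) (big_cat_nat (n := k)).
have [lt_n|le_n] := ltnP n (f b).
  have lt_bm : (b < m)%N by rewrite ltnNge; apply/negP=> /f0; lia.
  rewrite (cnt b.+1) // (eq_big_nat _ _ (F2 := fun=> 1%N)) => [|r r_b].
    by rewrite sum_nat_const_nat; lia.
  by have := nonincr r b; lia.
apply/esym/negbTE; rewrite -leqNgt; have [le_mb|lt_bm] := leqP m b.
  apply: leq_trans le_mb; rewrite -[X in (_ <= X)%N](card_ord m) -sum1_card.
  by apply: leq_sum => r _; case: (_ < _)%N.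
rewrite (cnt b) ?(ltnW lt_bm) // [X in (_ + X)%N]big_nat_cond [X in (_ + X)%N]big1 ?addn0.
  rewrite -[X in (_ <= X)%N](subn0 b) -[X in (_ <= X)%N]muln1 -sum_nat_const_nat.
  by apply: leq_sum => r _; case: (_ < _)%N.
by move=> r r_b; have := nonincr b r; case: ltnP => //; lia.
Qed.

(** The tail sizes agree for both bases; their successive differences are the parts of the conjugate
    partitions, which determine the partitions. *)
Lemma jordan_strings_unique (P : seq nat) z (m : nat) (f : nat -> nat) z' :
  (forall b c, b <= c -> nth 0%N P c <= nth 0%N P b)%N ->
  (forall b c, b <= c -> f c <= f b)%N -> (forall b, m <= b -> f b = 0)%N ->
  jordan_strings (fun r : 'I_(size P) => nth 0%N P r) z ->
  jordan_strings (fun r : 'I_m => f r) z' ->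
  forall b, nth 0%N P b = f b.
Proof.
move=> P_nonincr f_nonincr f0 PJ fJ b.
have tails n : (\sum_(r < size P) (nth 0 P r - n) = \sum_(r < m) (f r - n))%N.
  apply/eqP; rewrite eqn_leq -!card_string_tail (jordan_strings_tail_le n PJ fJ).
  exact: jordan_strings_tail_le n fJ PJ.
have step s (g : 'I_s -> nat) n :
    (\sum_r (g r - n) = \sum_r (g r - n.+1) + \sum_r (n < g r))%N.
  by rewrite -big_split; apply: eq_bigr => r _ /=; case: ltnP; lia.
have gtE n : (n < nth 0%N P b)%N = (n < f b)%N.
  rewrite (nonincr_count _ _ P_nonincr (fun b => @nth_default _ 0%N P b)).
  rewrite (nonincr_count _ _ f_nonincr f0).
  have := tails n; rewrite !(step _ _ n) tails => /addnI.
  by move=> ->.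
by apply/eqP; rewrite eqn_leq leqNgt gtE -leqNgt leqnn /= leqNgt -gtE -leqNgt leqnn.
Qed.

End JordanStrings.

(** * Division by a linear form *)

Section LinearForms.

Variable K : fieldType.
Local Notation R := {mpoly K[2]}.

Lemma ord2P (i : 'I_2) : i = 0 \/ i = 1.
Proof. by case: i => [[|[|//]]] lt_i; [left | right]; apply/val_inj. Qed.

Lemma complementary_form (v : 'I_2 -> K) : linear_form v != 0 ->
  exists2 w : R, w \is 1.-homog &
    forall i : 'I_2, exists a b : K, 'X_i = a *: linear_form v + b *: w.
Proof.
have lE : linear_form v = v 0 *: 'X_0 + v 1 *: 'X_1 :> R.
  rewrite /linear_form big_ord_recl big_ord1.
  by have -> : lift ord0 ord0 = 1 :> 'I_2 by apply/val_inj.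
have homX (i : 'I_2) : 'X_i \is 1.-homog :> bool by rewrite dhomogX /= mdeg1.
have [v0|v0] := eqVneq (v 0) 0; last first.
  move=> _; exists 'X_1 => // i; case: (ord2P i) => ->.
    exists (v 0)^-1, (- (v 0)^-1 * v 1); rewrite lE scalerDr !scalerA mulVf //.
    by rewrite scale1r mulNr scaleNr addrK.
  by exists 0, 1; rewrite scale0r scale1r add0r.
have [v1|v1] := eqVneq (v 1) 0; first by rewrite lE v0 v1 !scale0r addr0 eqxx.
move=> _; exists 'X_0 => // i; case: (ord2P i) => ->.
  by exists 0, 1; rewrite scale0r scale1r add0r.
exists (v 1)^-1, 0; rewrite lE v0 scale0r add0r scalerA mulVf //.
by rewrite scale1r addr0.
Qed.

Variables l w : R.
Hypothesis X_lw : forall i : 'I_2, exists a b : K, 'X_i = a *: l + b *: w.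
Hypotheses (l_hom : l \is 1.-homog) (w_hom : w \is 1.-homog).

Lemma exp_hom (u : R) n : u \is 1.-homog -> u ^+ n \is n.-homog.
Proof. by move=> hom_u; have := dhomogMn n hom_u; rewrite mul1n. Qed.

(** Modulo [l] the ring becomes [K[w]]. Starting at degree [i.+1] keeps the degree of the cofactor
    untruncated. *)
Lemma mod_form_decomp i (f : R) : f \is i.+1.-homog ->
  exists c g, g \is i.-homog /\ f = c *: w ^+ i.+1 + l * g.
Proof.
elim: i f => [|i IHi] f; elim/dhomog_ind => {f}.
- by exists 0, 0; rewrite rpred0 scale0r mulr0 addr0.
- move=> a f g [c [f' [hom_f' ->]]] [c' [g' [hom_g' ->]]].
  exists (a * c + c'), (a *: f' + g'); split; first by rewrite rpredD ?rpredZ.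
  by rewrite scalerDr scalerDl mulrDr scalerA -scalerAr addrACA.
- move=> m /eqP/mdeg1P[i /eqP->]; have [a [b ->]] := X_lw i.
  exists b, a%:MP; rewrite expr1 addrC mulrC mul_mpolyC; split=> //.
  by rewrite -[a%:MP]mulr1 mul_mpolyC rpredZ // dhomog1.
- by exists 0, 0; rewrite rpred0 scale0r mulr0 addr0.
- move=> a f g [c [f' [hom_f' ->]]] [c' [g' [hom_g' ->]]].
  exists (a * c + c'), (a *: f' + g'); split; first by rewrite rpredD ?rpredZ.
  by rewrite scalerDr scalerDl mulrDr scalerA -scalerAr addrACA.
move=> m deg_m; have [u mu] : exists u, m u != 0%N.
  apply/existsP; apply: contraT; rewrite negb_exists => /forallP m0.
  by move: deg_m; rewrite mdegE big1 // => u _; apply/eqP; have := m0 u; rewrite negbK.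
have mE : m = (U_(u) + (m - U_(u)))%MM by rewrite addmC submK // lep1mP.
have hom_mu : ('X_[m - U_(u)] : R) \is i.+1.-homog.
  by rewrite dhomogX /=; apply/eqP/succn_inj; rewrite -deg_m [in RHS]mE mdegD mdeg1.
have [c [g [hom_g gE]]] := IHi _ hom_mu.
have [a [b Xu]] := X_lw u; rewrite mE mpolyXD gE Xu.
exists (b * c), (a *: (c *: w ^+ i.+1 + l * g) + b *: (w * g)); split.
  apply: rpredD; apply: rpredZ; last by rewrite -[i.+1]add1n dhomogM.
  by apply: rpredD; [rewrite rpredZ // exp_hom | rewrite -[i.+1]add1n dhomogM].
rewrite [w ^+ i.+2]exprS; move: (w ^+ i.+1) => W.
by rewrite -!mul_mpolyC mpolyCM; ring.
Qed.

(** The products of [l] with the components of [g] have distinct degrees, so a single component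
    already gives [l * g]. *)
Lemma hom_form_quotient i g : l * g \is i.-homog ->
  l * g = 0 \/ exists i' g', [/\ i = i'.+1, g' \is i'.-homog & l * g = l * g'].
Proof.
move=> hom_lg; rewrite -(pihomog_dE hom_lg).
pose k := maxn i.+1 (msize g).
have -> : pihomog mdeg i (l * g) =
    \sum_(d < k) pihomog mdeg i (l * pihomog mdeg d g).
  rewrite {1}(@pihomog_partitionE _ _ mdeg k g) ?leq_maxr //.
  by rewrite mulr_sumr raddf_sum.
have hom_d d : l * pihomog mdeg d g \is d.+1.-homog.
  by rewrite -[d.+1]add1n dhomogM // pihomogP.
case: i @k {hom_lg} => [|i] k.
  by left; rewrite big1 // => d _; apply: (pihomog_ne0 _ (hom_d d)).
have lt_i : (i < k)%N by rewrite leq_max; apply/orP; left; exact: leqnSn.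
right; exists i, (pihomog mdeg i g); split; rewrite ?pihomogP //.
rewrite (bigD1 (Ordinal lt_i)) //= pihomog_dE // big1 ?addr0 // => d ne_d.
by apply: (pihomog_ne0 _ (hom_d d)); rewrite eqSS.
Qed.

Definition monic_mod_form (b : nat) (f : R) : Prop :=
  f \is b.-homog /\ exists g, f = w ^+ b + l * g.

Lemma monic_exp b : monic_mod_form b (w ^+ b).
Proof. by split; [exact: exp_hom | exists 0; rewrite mulr0 addr0]. Qed.

Lemma monic_mulw b f : monic_mod_form b f -> monic_mod_form b.+1 (w * f).
Proof.
move=> [hom_f [g fE]]; split; first by rewrite -[b.+1]add1n dhomogM.
by exists (w * g); rewrite fE exprS; ring.
Qed.

Lemma monic_addl b n f h : monic_mod_form b f -> (n < b)%N -> h \is n.-homog ->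
  monic_mod_form b (f + l ^+ (b - n) * h).
Proof.
move=> [hom_f [g fE]] lt_nb hom_h; split.
  by rewrite rpredD // -{2}(subnK (ltnW lt_nb)) dhomogM ?exp_hom.
exists (g + l ^+ (b - n).-1 * h); have -> : (b - n)%N = (b - n).-1.+1 by lia.
by rewrite fE exprS /=; ring.
Qed.

(** Factors [l] are split off until the coefficient of the pure power of [w] is nonzero. *)
Lemma hom_lead i (f : R) : f \is i.-homog -> f != 0 ->
  exists b c g, [/\ (b <= i)%N, c != 0, monic_mod_form b g & f = c *: (l ^+ (i - b) * g)].
Proof.
elim: i f => [|i IHi] f hom_f f_neq0.
  exists 0%N, f@_0, 1; have fE : f = f@_0 *: 1.
    apply/mpolyP=> m; rewrite mcoeffZ mcoeff1; have [->|ne_m] := eqVneq m 0%MM.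
      by rewrite mulr1.
    by rewrite mulr0; apply: dhomog_nemf_coeff hom_f _; rewrite mdeg_eq0.
  split; rewrite ?expr0 ?mul1r //; last exact: (monic_exp 0).
  by apply: contraNneq f_neq0 => f0; rewrite fE f0 scale0r.
have [c [g [hom_g fE]]] := mod_form_decomp hom_f.
have [c0|c_neq0] := eqVneq c 0.
  have g_neq0 : g != 0.
    by apply: contraNneq f_neq0 => g0; rewrite fE c0 g0 scale0r mulr0 addr0.
  have [b [a [h [le_b a_neq0 mon_h gE]]]] := IHi g hom_g g_neq0.
  exists b, a, h; split=> //; first exact: leqW.
  by rewrite fE c0 gE scale0r add0r subSn // exprS -scalerAr mulrA.
exists i.+1, c, (w ^+ i.+1 + l * (c^-1 *: g)); split=> //.
  split; last by exists (c^-1 *: g).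
  by rewrite rpredD ?exp_hom // -[i.+1]add1n dhomogM ?rpredZ.
by rewrite subnn mul1r scalerDr -scalerAr scalerA divff // scale1r.
Qed.

End LinearForms.

(** * Strings of a linear form in a Gorenstein quotient *)

Section Annihilator.

Variables (K : fieldType) (F : {mpoly K[2]}).
Local Notation R := {mpoly K[2]}.

Lemma Ann0 : Ann F 0.
Proof. by rewrite /Ann -[LHS]/(diff_actl F 0) linear0. Qed.

Lemma AnnD a f g : Ann F f -> Ann F g -> Ann F (a *: f + g).
Proof. by rewrite /Ann diff_actP => -> ->; rewrite scaler0 addr0. Qed.

Lemma AnnM f g : Ann F g -> Ann F (f * g).
Proof. by rewrite /Ann diff_actM => ->; rewrite linear0. Qed.

Lemma AnnZ a f : Ann F f -> Ann F (a *: f).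
Proof. by move=> Ff; rewrite -[_ *: _]addr0; apply: AnnD Ann0. Qed.

Lemma AnnZ_inv a f : a != 0 -> Ann F (a *: f) -> Ann F f.
Proof. by move=> a0 /(AnnZ a^-1); rewrite scalerA mulVf // scale1r. Qed.

End Annihilator.

Section LinearStrings.

Variables (K : fieldType) (F : {mpoly K[2]}) (j : nat) (v : 'I_2 -> K) (w : {mpoly K[2]}).
Local Notation R := {mpoly K[2]}.
Local Notation l := (linear_form v).
Local Notation I := (Ann F).
Hypothesis charK0 : [pchar K] =i pred0.
Hypothesis F_hom : F \is j.-homog.
Hypothesis X_lw : forall i : 'I_2, exists a b : K, 'X_i = a *: l + b *: w.
Hypothesis w_hom : w \is 1.-homog.
Local Notation l_hom := (linear_form_homog v).
Local Notation monic := (monic_mod_form l w).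

Lemma Ann_gt_degree i f : f \is i.-homog -> (j < i)%N -> I f.
Proof. by move=> hom_f; apply: diff_act_gt_degree. Qed.

Lemma Ann_pairing i h : h \is i.-homog -> (i <= j)%N ->
  (forall f, f \is (j - i).-homog -> I (f * h)) -> I h.
Proof.
move=> hom_h le_ij Ih; apply: (diff_act_nondegenerate charK0).
  exact: diff_act_homog hom_h F_hom.
by move=> f /Ih; rewrite /Ann diff_actM.
Qed.

(** Every form of degree [j - i] is a multiple of [w ^+ (j - i)] modulo [l], so the pairing of [h]
    with that degree is tested on this power alone. *)
Lemma Ann_socle_test i h : h \is i.-homog -> (i <= j)%N ->
  I (l * h) -> I (w ^+ (j - i) * h) -> I h.
Proof.
move=> hom_h le_ij Ilh Iwh; case Eji: (j - i)%N => [|n].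
  by move: Iwh; rewrite Eji mul1r.
apply: (Ann_pairing hom_h le_ij) => f; rewrite Eji.
move=> /(mod_form_decomp X_lw l_hom w_hom)[c [g [_ ->]]].
rewrite mulrDl -scalerAl [l * g]mulrC -[g * l * h]mulrA -Eji.
by apply: AnnD => //; apply: AnnM.
Qed.

(* In the coordinates (l, w), the monomials l^n w^b with q b <= n are those of
   an initial ideal of I. *)
Definition leading_exponents (q : nat -> nat) (e : nat -> R) : Prop :=
  [/\ forall b, monic b (e b), forall b, I (l ^+ q b * e b)
    & forall b n f, monic b f -> I (l ^+ n * f) -> (q b <= n)%N].

Lemma leading_exponents_exist : exists q e, leading_exponents q e.
Proof.
pose Q b n := exists2 f, monic b f & I (l ^+ n * f).
have minQ b : exists n, Q b n /\ forall n', Q b n' -> (n <= n')%N.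
  have : exists n, Q b n.
    (* The product has degree [j.+1 + b], beyond the degree of [F]. *)
    exists j.+1, (w ^+ b); first exact: monic_exp.
    by apply: Ann_gt_degree (dhomogM (exp_hom _ l_hom) (exp_hom _ w_hom)) _; lia.
  case=> n; have [m] := ubnP n; elim: m n => // m IHm n lt_nm Qn.
  have [[n' lt_n' Qn']|min_n] := classic (exists2 n', (n' < n)%N & Q b n').
    by apply: (IHm n') => //; lia.
  exists n; split=> // n' Qn'; rewrite leqNgt; apply/negP=> lt_n'.
  by apply: min_n; exists n'.
pose q b := proj1_sig (constructive_indefinite_description _ (minQ b)).
have qP b : Q b (q b) /\ forall n', Q b n' -> (q b <= n')%N.
  exact: (proj2_sig (constructive_indefinite_description _ (minQ b))).
have ex_e b : exists f, monic b f /\ I (l ^+ q b * f).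
  by have [[f mon_f If] _] := qP b; exists f.
exists q, (fun b => proj1_sig (constructive_indefinite_description _ (ex_e b))).
have eP b := proj2_sig (constructive_indefinite_description _ (ex_e b)).
split=> [b|b|b n f mon_f If]; [by case: (eP b) | by case: (eP b) |].
by apply: (qP b).2; exists f.
Qed.

Variables (q : nat -> nat) (e : nat -> R).
Hypothesis qeP : leading_exponents q e.

Let e_monic b : monic b (e b). Proof. by case: qeP. Qed.
Let e_in b : I (l ^+ q b * e b). Proof. by case: qeP. Qed.
Let q_min b n f : monic b f -> I (l ^+ n * f) -> (q b <= n)%N.
Proof. by case: qeP => _ _; apply. Qed.
Let e_hom b : e b \is b.-homog. Proof. by case: (e_monic b). Qed.

Lemma string_hom b n : l ^+ n * e b \is (b + n).-homog.
Proof. by rewrite addnC dhomogM // exp_hom // l_hom. Qed.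

Lemma leading_exponent_le b : (q b <= j.+1 - b)%N.
Proof.
apply: (q_min (e_monic b)); apply: Ann_gt_degree (string_hom b _) _; lia.
Qed.

(** Multiplying [e c] by [w] gives a competitor for row [c.+1] killed by the same power of [l]. *)
Lemma leading_exponent_nonincr b c : (b <= c)%N -> (q c <= q b)%N.
Proof.
elim: c => [|c IHc]; first by rewrite leqn0 => /eqP->.
rewrite leq_eqVlt => /predU1P[->//|/IHc]; apply: leq_trans.
apply: (@q_min _ _ (w * e c)); first exact: (monic_mulw w_hom).
by rewrite mulrCA; apply: AnnM.
Qed.

Lemma string_elem_notin b n : (n < q b)%N -> ~ I (l ^+ n * e b).
Proof. by move=> lt_n /(q_min (e_monic b)); lia. Qed.

(** Rows beyond [j] are empty by [leading_exponent_le], so the indices in ['I_j.+1] lose no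
    string. *)
Local Notation Q := (fun r : 'I_j.+1 => q r).
Local Notation z := (fun r : 'I_j.+1 => e r).
Local Notation in_span := (span_mod I predT (@string_elem K l j.+1 Q z)).

Lemma string_in_span b n : in_span (l ^+ n * e b).
Proof.
have [lt_n|le_n] := ltnP n (q b); last first.
  exact: span_mod_in (string_in (@AnnM _ F) (e_in b) le_n).
have lt_b : (b < j.+1)%N by have := leading_exponent_le b; lia.
pose u := Tagged (fun r => 'I_(Q r)) (Ordinal lt_n : 'I_(Q (Ordinal lt_b))).
by rewrite -[_ * _]/(string_elem l z u); apply: span_mod_elem; first exact: Ann0.
Qed.

(** Subtracting the string element with the same leading term leaves a multiple of [l] whose
    cofactor has smaller degree; the free exponent [n] absorbs this [l]. *)
Lemma hom_in_span i n f : f \is i.-homog -> in_span (l ^+ n * f).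
Proof.
have [m] := ubnP i; elim: m i n f => // m IHm i n f lt_im hom_f.
have [->|f_neq0] := eqVneq f 0; first by rewrite mulr0; apply: span_mod_in; exact: Ann0.
have [b [c [g [le_b _ [hom_g [g' gE]] ->]]]] := hom_lead X_lw l_hom w_hom hom_f f_neq0.
have [hom_e [g'' eE]] := e_monic b.
have -> : l ^+ n * (c *: (l ^+ (i - b) * g)) =
    c *: (l ^+ (n + (i - b)) * e b) + (c *: (l ^+ (n + (i - b)) * (g - e b)) + 0).
  by rewrite addr0 -scalerDr -mulrDr addrC subrK exprD -scalerAr mulrA.
apply: span_mod_comb; [exact: AnnD | exact: string_in_span |].
apply: span_mod_comb; [exact: AnnD | | by apply: span_mod_in; exact: Ann0].
have geE : g - e b = l * (g' - g'') by rewrite gE eE; ring.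
have : l * (g' - g'') \is b.-homog by rewrite -geE rpredB.
rewrite geE => /(hom_form_quotient l_hom)[->|[i' [h [bE hom_h ->]]]].
  by rewrite mulr0; apply: span_mod_in; exact: Ann0.
by rewrite mulrA -exprSr; apply: (IHm i') => //; lia.
Qed.

(** In a relation within one degree, the highest row [tag u0] that occurs has the least power of
    [l]. Factoring it out leaves a scalar multiple of a competitor for that row, killed by a power
    below [q]. *)
Lemma hom_strings_free i (A : pred {r : 'I_j.+1 & 'I_(Q r)})
    (c : {r : 'I_j.+1 & 'I_(Q r)} -> K) :
  (forall u, A u -> (tag u + tagged u)%N = i) ->
  I (\sum_(u | A u) c u *: string_elem l z u) -> forall u, A u -> c u = 0.
Proof.
move=> degA Isum u Au; apply/eqP; apply: contraT => cu_neq0.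
pose B u := A u && (c u != 0).
have Bu : B u by rewrite /B Au.
pose row (u1 : {r : 'I_j.+1 & 'I_(Q r)}) : nat := tag u1.
case: (arg_maxnP row Bu) => u0 /andP[Au0 cu0] max_u0.
rewrite {}/row in max_u0.
have B_lt u1 : B u1 && (u1 != u0) ->
    (tag u1 < tag u0)%N /\ (tagged u1 = tagged u0 + (tag u0 - tag u1) :> nat)%N.
  move=> /andP[Bu1 ne_u1]; have := max_u0 _ Bu1; case/andP: Bu1 => Au1 _.
  have := degA _ Au1; have := degA _ Au0; move: u0 u1 ne_u1 {max_u0 Au0 Au1 cu0}.
  move=> [b0 t0] [b1 t1] /= ne_u1 deg0 deg1 le_b.
  suff : (b1 < b0)%N by lia.
  rewrite ltn_neqAle le_b andbT; apply: contraNneq ne_u1 => eq_b.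
  have {eq_b} eq_b : b1 = b0 by apply: val_inj.
  rewrite -{}eq_b in t0 deg0 *.
  by apply/eqP; congr (Tagged _ _); apply: val_inj => /=; lia.
pose f := e (tag u0) + \sum_(u1 | B u1 && (u1 != u0))
  l ^+ (tag u0 - tag u1) * (((c u0)^-1 * c u1) *: e (tag u1)).
have mon_f : monic (tag u0) f.
  rewrite /f; elim/big_rec: _ => [|u1 S /B_lt[lt_b _] IHS]; first by rewrite addr0.
  rewrite [X in _ + X]addrC addrA; apply: (monic_addl l_hom w_hom IHS lt_b).
  by apply: rpredZ; exact: e_hom.
suff /(q_min mon_f) : I (l ^+ tagged u0 * f) by have := ltn_ord (tagged u0); lia.
apply: (AnnZ_inv cu0); move: Isum; congr (I _).
rewrite (bigD1 u0) //= /f mulrDr scalerDr; congr (_ + _).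
rewrite (bigID (fun u => c u != 0)) /= [X in _ + X]big1 ?addr0; last first.
  by move=> u1 /andP[_]; rewrite negbK => /eqP->; rewrite scale0r.
rewrite mulr_sumr scaler_sumr; apply: eq_big => [u1|u1 Bu1]; first by rewrite /B andbAC.
have [] := B_lt u1; first by rewrite /B andbAC.
move=> _ tE; rewrite /string_elem tE exprD -!scalerAr scalerA mulrA mulrA divff //.
by rewrite mul1r.
Qed.

Lemma leading_jordan_strings : jordan_strings I l Q z.
Proof.
split=> [r|]; first exact: e_in.
split=> // [f _|c Ic u].
  suff [c cE] : in_span f.
    by exists c.
  rewrite (@pihomog_partitionE _ _ mdeg (msize f) f) //.
  elim/big_rec: _ => [|i g _ IHg]; first by apply: span_mod_in; exact: Ann0.
  rewrite -[pihomog _ _ _]scale1r; apply: span_mod_comb => //; first exact: AnnD.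
  by have := hom_in_span 0 (pihomogP mdeg i f); rewrite mul1r.
pose i := (tag u + tagged u)%N.
pose A := [pred u : {r : 'I_j.+1 & 'I_(Q r)} | (tag u + tagged u)%N == i].
apply: (@hom_strings_free i A c _ _ u) => //=; first by move=> u1 /eqP.
have := diff_act_pihomog i F_hom Ic; rewrite -/(Ann _ _); congr (I _).
rewrite raddf_sum (bigID A) /= [X in _ + X]big1 ?addr0.
  apply: eq_bigr => u1 /eqP u1i; apply: pihomog_dE.
  by apply: rpredZ; rewrite -u1i; apply: string_hom.
move=> u1 ne_u1; apply: pihomog_ne0 ne_u1 _.
by apply: rpredZ; apply: string_hom.
Qed.

Lemma jordan_typeE (P : seq nat) b : is_jordan_type I l P -> nth 0%N P b = q b.
Proof.
case=> P_part [y [Iy basis_y]].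
apply: (jordan_strings_unique (Ann0 F) (@AnnD _ F) (@AnnM _ F)
  (z := y) (z' := z) (m := j.+1) (l := l)).
- by move=> b' c; apply: partition_nonincr.
- exact: leading_exponent_nonincr.
- by move=> b' lt_jb; have := leading_exponent_le b'; lia.
- by split.
exact: leading_jordan_strings.
Qed.

(** * The permutation given by the ends of the strings *)

Local Notation hand b := (l ^+ (q b).-1 * e b).

(* The permutation sigma of the rows b with 0 < q b; the subtraction is not
   truncated, by [leading_exponent_le]. *)
Definition end_codegree b := (j.+1 - (q b + b))%N.

Lemma end_codegreeE b : (0 < q b)%N -> (q b + b + end_codegree b = j.+1)%N.
Proof. by have := leading_exponent_le b; rewrite /end_codegree; lia. Qed.

Lemma hand_hom b : (0 < q b)%N -> hand b \is (j - end_codegree b).-homog.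
Proof.
move=> q_gt0; have -> : (j - end_codegree b = b + (q b).-1)%N.
  by have := end_codegreeE q_gt0; lia.
exact: string_hom.
Qed.

Lemma hand_killed b : (0 < q b)%N -> I (l * hand b).
Proof. by move=> q_gt0; rewrite mulrA -exprS prednK. Qed.

Lemma hand_notin b : (0 < q b)%N -> ~ I (hand b).
Proof. by move=> q_gt0; apply: string_elem_notin; rewrite prednK. Qed.

Lemma hand_socle_test b h : (0 < q b)%N -> h \is (j - end_codegree b).-homog ->
  I (l * h) -> I (w ^+ end_codegree b * h) -> I h.
Proof.
move=> q_gt0 hom_h Ilh Iwh; apply: (Ann_socle_test hom_h) => //; first exact: leq_subr.
by have Eb := end_codegreeE q_gt0; rewrite subKn //; lia.
Qed.

(** If [q] vanished at this index, its [e] would lie in [I], so the power of [w] would be a multiple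
    of [l] modulo [I]. It would kill the hand of [b], against the socle test. *)
Lemma end_codegree_gt0 b : (0 < q b)%N -> (0 < q (end_codegree b))%N.
Proof.
move=> q_gt0; rewrite lt0n; apply/eqP=> q0; apply: (hand_notin q_gt0).
apply: (hand_socle_test q_gt0 (hand_hom q_gt0) (hand_killed q_gt0)).
have := e_in (end_codegree b); rewrite q0 mul1r.
have [_ [g ->]] := e_monic (end_codegree b) => Iwg.
rewrite -[w ^+ _](addrK (l * g)) mulrBl addrC -scaleN1r.
apply: AnnD; first by rewrite [l * g]mulrC -mulrA; apply/AnnM/hand_killed.
by rewrite mulrC; apply: AnnM.
Qed.

Lemma end_codegree_inj b c : (0 < q b)%N -> (0 < q c)%N ->
  end_codegree b = end_codegree c -> b = c.
Proof.
wlog lt_bc : b c / (b < c)%N.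
  move=> main qb qc bc; have [lt_bc|lt_cb|//] := ltngtP b c; first exact: main.
  by apply/esym/main.
move=> qb qc bc; exfalso.
have Eb := end_codegreeE qb; have Ec := end_codegreeE qc; rewrite -bc in Ec.
set n := end_codegree b in bc Eb Ec *.
(* Both hands have degree j - n, and w^n maps this degree to the
   one-dimensional socle degree. *)
have dim1 f : f \is (j - n).-homog -> diff_act (w ^+ n * f) F \is 0.-homog.
  move=> hom_f; have := diff_act_homog (dhomogM (exp_hom n w_hom) hom_f) F_hom.
  by have -> : (j - (n + (j - n)) = 0)%N by lia.
have hom_b := hand_hom qb; have hom_c := hand_hom qc.
rewrite -bc in hom_c; rewrite -/n in hom_b hom_c.
pose pairing f := (diff_act (w ^+ n * f) F).@[v].
have pairing0 f : f \is (j - n).-homog -> pairing f = 0 -> I (w ^+ n * f).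
  by move=> hom_f; apply: dhomog0_eval0; apply: dim1.
have pc_neq0 : pairing (hand c) != 0.
  apply/eqP=> /(pairing0 _ hom_c) Iwc; apply: (hand_notin qc).
  by apply: (hand_socle_test qc); rewrite -?bc //; apply: hand_killed.
have pb_neq0 : pairing (hand b) != 0.
  apply/eqP=> /(pairing0 _ hom_b) Iwb; apply: (hand_notin qb).
  by apply: (hand_socle_test qb) => //; apply: hand_killed.
(* With this [a], the combination [a *: hand b + hand c] is killed by both [l] and [w ^+ n], hence
   lies in [I]; it equals [l ^+ (q c).-1 * f] with [f] monic, against the minimality of [q c]. *)
pose a := - pairing (hand c) / pairing (hand b).
pose f := e c + l ^+ (c - b) * (a *: e b).
have mon_f : monic c f.
  apply: (monic_addl l_hom w_hom (e_monic c) lt_bc); apply: rpredZ.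
  exact: e_hom.
have fE : l ^+ (q c).-1 * f = a *: hand b + hand c.
  rewrite /f mulrDr addrC mulrA -exprD -scalerAr; congr (_ *: (l ^+ _ * _) + _); lia.
have : I (l ^+ (q c).-1 * f).
  rewrite fE; apply: (hand_socle_test qb); rewrite -/n.
  - by rewrite rpredD ?rpredZ.
  - by rewrite mulrDr -scalerAr; apply: AnnD; apply: hand_killed.
  apply: pairing0; first by rewrite rpredD ?rpredZ.
  rewrite /pairing mulrDr -scalerAr diff_actP mevalD mevalZ -/(pairing _) -/(pairing _).
  by rewrite /a mulrAC -mulrA divff // mulr1 addNr.
by move=> /(q_min mon_f); lia.
Qed.

(** By Euler, an entry of the Hessian matrix vanishes at [v] exactly when [l ^+ (j - i - i)] times
    the product of its two basis elements is in [I]. A kernel vector is thus a form [f] whose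
    multiple by this power pairs to zero with degree [i]. *)
Lemma hessian_eq0 i n (alpha : 'I_n -> R) : (i <= j - i)%N ->
  graded_basis I i alpha ->
  (hessian F alpha).@[v] = 0 <->
  exists f, [/\ f \is i.-homog, ~ I f & I (l ^+ (j - i - i) * f)].
Proof.
move=> le_i [hom_alpha span_alpha free_alpha].
pose pairing f := (diff_act f F).@[v].
have pairingE f : f \is (i + i).-homog ->
    pairing f = 0 <-> I (l ^+ (j - i - i) * f).
  move=> hom_f; have hom_fF := diff_act_homog hom_f F_hom.
  have := diff_act_linear_form_exp v hom_fF; rewrite subnDA -diff_actM => E.
  have hom0 : diff_act (l ^+ (j - i - i) * f) F \is 0.-homog.
    have := diff_act_homog (dhomogM (exp_hom (j - i - i) l_hom) hom_f) F_hom.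
    by have -> : (j - (j - i - i + (i + i)) = 0)%N by lia.
  have fact_neq0 : ((j - i - i)`!)%:R != 0 :> K.
    by rewrite (pcharf0P K).1 // -lt0n fact_gt0.
  split=> [f0|If].
    by apply: (dhomog0_eval0 (v := v) hom0); rewrite E -/(pairing f) f0 mulr0.
  apply/eqP; have := E; rewrite [diff_act _ _ in LHS]If meval0 => /esym/eqP.
  by rewrite mulf_eq0 (negbTE fact_neq0).
pose M := \matrix_(u, x) pairing (alpha u * alpha x).
have -> : (hessian F alpha).@[v] = \det M.
  rewrite /hessian -det_map_mx; congr (\det _).
  by apply/matrixP=> u x; rewrite !mxE.
have combE (y : 'rV_n) x : (y *m M) 0 x = pairing ((\sum_u y 0 u *: alpha u) * alpha x).
  rewrite mxE mulr_suml /pairing diff_act_suml raddf_sum; apply: eq_bigr => u _ /=.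
  by rewrite -scalerAl diff_actZl mevalZ mxE.
have hom_comb (y : 'rV_n) : \sum_u y 0 u *: alpha u \is i.-homog.
  by apply: rpred_sum => u _; apply: rpredZ.
split=> [/eqP/det0P[y y_neq0 yM]|[f [hom_f nIf If]]].
  pose f := \sum_u y 0 u *: alpha u; exists f; split; first exact: hom_comb.
    by move=> /free_alpha y0; case/eqP: y_neq0; apply/rowP=> u; rewrite y0 mxE.
  have hom_lf : l ^+ (j - i - i) * f \is (j - i).-homog.
    have := dhomogM (exp_hom (j - i - i) l_hom) (hom_comb y).
    by have -> : (j - i - i + i = j - i)%N by lia.
  apply: (Ann_pairing hom_lf) => [|g]; first exact: leq_subr.
  rewrite subKn; last by lia.
  move=> /span_alpha[c Ic].
  rewrite -[g](subrK (\sum_u c u *: alpha u)) mulrDl -[X in X + _]scale1r; apply: AnnD.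
    by rewrite mulrC; apply: AnnM.
  rewrite mulr_suml; elim/big_rec: _ => [|x S _]; first exact: Ann0.
  rewrite -scalerAl; apply: AnnD; rewrite mulrCA [alpha x * f]mulrC.
  apply/pairingE; first exact: dhomogM (hom_comb y) (hom_alpha x).
  by rewrite -combE yM mxE.
apply/eqP/det0P; have [c Ic] := span_alpha f hom_f.
pose y := \row_u c u; have yE : \sum_u c u *: alpha u = \sum_u y 0 u *: alpha u.
  by apply: eq_bigr => u _; rewrite mxE.
exists y.
  apply/eqP=> y0; apply: nIf; move: Ic; rewrite yE y0.
  by rewrite big1 ?subr0 // => u _; rewrite mxE scale0r.
apply/rowP=> x; rewrite combE mxE; apply/pairingE.
  exact: dhomogM (hom_comb y) (hom_alpha x).
rewrite -yE mulrA; rewrite mulrC; apply: AnnM.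
rewrite -[X in _ * X](subKr f) mulrBr addrC -scaleN1r; apply: AnnD => //.
exact: AnnM.
Qed.

(** The elements [l ^+ (i - b) * e b] with [b <= i] lead the forms of degree [i]. Multiplication by
    [l ^+ (j - i - i)] gives the exponent [j - i - b], which is at least [q b] exactly when
    [end_codegree b > i]. *)
Lemma hessian_block_end i n (alpha : 'I_n -> R) : (i <= j - i)%N ->
  (forall b, (b <= i)%N -> (i - b < q b)%N) -> graded_basis I i alpha ->
  (hessian F alpha).@[v] = 0 <-> ~ block_end end_codegree i.
Proof.
move=> le_i q_full /(hessian_eq0 le_i) ->.
split=> [[f [hom_f nIf If]] stab|not_stab].
  have f_neq0 : f != 0 by apply/eqP=> f0; apply: nIf; rewrite f0; apply: Ann0.
  have [b [c [g [le_b c_neq0 mon_g fE]]]] := hom_lead X_lw l_hom w_hom hom_f f_neq0.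
  move: If; rewrite fE -scalerAr mulrA -exprD => /(AnnZ_inv c_neq0)/(q_min mon_g).
  by have := stab b le_b; have := q_full b le_b; rewrite /end_codegree; lia.
have [b le_b lt_b] : exists2 b, (b <= i)%N & (i < end_codegree b)%N.
  apply: NNPP => no_b; apply: not_stab => b le_b; rewrite leqNgt; apply/negP=> lt_b.
  by apply: no_b; exists b.
exists (l ^+ (i - b) * e b); split.
- by have := string_hom b (i - b); rewrite subnKC.
- exact/string_elem_notin/q_full.
rewrite mulrA -exprD; apply: (string_in (@AnnM _ F) (e_in b)).
by move: lt_b; rewrite /end_codegree; lia.
Qed.

End LinearStrings.

(** * Hessians compared with hook counts *)

Theorem proposition4p9 (K : fieldType) (charK0 : [pchar K] =i pred0)
  (d k : nat) (d_gt0 : (0 < d)%N) (k_gt0 : (0 < k)%N)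
  (F : {mpoly K[2]}) (homF : F \is (socle_degree d k).-homog)
  (A_CI : graded_artinian_CI (Ann F))
  (A_T : has_hilbert_function (Ann F) (hilbT d k))
  (v : 'I_2 -> K) (l_neq0 : linear_form v != 0)
  (P : seq nat) (P_CIJT : is_CIJT K (hilbT d k) P)
  (P_l : is_jordan_type (Ann F) (linear_form v) P) :
  ((2 <= k)%N ->
     forall i : nat, (1 <= i <= d)%N ->
     forall alpha : 'I_(d - i).+1 -> {mpoly K[2]},
       graded_basis (Ann F) (d - i) alpha ->
       ((hessian F alpha).@[v] = 0 <->
        (diff_one_hooks P (socle_degree d k - (d - i))
           < if i == 1%N then 1 else 2)%N))
  /\
  (k = 1%N ->
     forall i : nat, (1 <= i <= d - 1)%N ->
     forall alpha : 'I_(d - 1 - i).+1 -> {mpoly K[2]},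
       graded_basis (Ann F) (d - 1 - i) alpha ->
       ((hessian F alpha).@[v] = 0 <->
        (diff_one_hooks P (socle_degree d k - (d - 1 - i)) < 2)%N)).
Proof.
have [P_part P_diag _] := P_CIJT.
have [w w_hom X_lw] := complementary_form l_neq0.
have [q [e qeP]] := leading_exponents_exist v homF w_hom.
have qE b : nth 0%N P b = q b := jordan_typeE homF X_lw w_hom qeP b P_l.
have q_gt0 b : (0 < q b)%N = (b < size P)%N by rewrite -qE partition_gt0.
set j := socle_degree d k in homF qeP *.
have jE : j = (2 * d + k - 3)%N by [].
pose sigma := end_codegree j q.
have sigmaE b : (b < size P)%N -> (nth 0 P b + b + sigma b = j.+1)%N.
  by rewrite -q_gt0 qE; apply: (end_codegreeE homF w_hom qeP).
have sigma_lt b : (b < size P)%N -> (sigma b < size P)%N.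
  by rewrite -!q_gt0; apply: (end_codegree_gt0 charK0 homF X_lw w_hom qeP).
have sigma_inj b c : (b < size P)%N -> (c < size P)%N -> sigma b = sigma c -> b = c.
  by rewrite -!q_gt0; apply: (end_codegree_inj charK0 homF X_lw w_hom qeP).
have hess i n (alpha : 'I_n -> {mpoly K[2]}) : (i < d)%N -> (i <= j - i)%N ->
    graded_basis (Ann F) i alpha ->
    (hessian F alpha).@[v] = 0 <-> ~ block_end sigma i.
  move=> lt_id le_i; apply: (hessian_block_end charK0 homF X_lw w_hom qeP le_i) => b le_b.
  by rewrite -qE; apply: (diag_length_full P_diag lt_id).
have hooks i := block_end_hooks P_part sigmaE sigma_lt sigma_inj d_gt0 k_gt0
  (erefl j) P_diag (i := i).
split=> [k_gt1|k1] i i_d alpha basis_alpha.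
  have lt_d : (d - i < d)%N by lia.
  have le_j : (d - i <= j - (d - i))%N by lia.
  rewrite (hess _ _ _ lt_d le_j basis_alpha).
  (* Only [i = 1] reaches degree [d - 1], where the next row may not exist; in lower degrees
     [(d - i).+1 < d]. *)
  case: (i =P 1%N) => [->|i_neq1]; last by apply: hooks; lia.
  exact: (block_end_top_hooks P_part sigmaE sigma_lt sigma_inj d_gt0 k_gt0 (erefl j)).
have lt_d : (d - 1 - i < d)%N by lia.
have le_j : (d - 1 - i <= j - (d - 1 - i))%N by lia.
by rewrite (hess _ _ _ lt_d le_j basis_alpha); apply: hooks; lia.
Qed.
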